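(* Let $n,m\ge1$, $\mathcal X\subseteq\mathbb Z^p\times\mathbb R^{n-p}$ with $0\le p\le n$, and $\Gamma\in[m]$. Consider the $\Gamma$-counterpart $$\inf_{x\in\mathcal X}\ \sup_{\mathcal S\subseteq[m]:|\mathcal S|\le\Gamma}\Big\{\sum_{i\in\mathcal S}\sup_{u_i\in\mathcal U_i}f_i(x,u_i)+\sum_{i\in[m]\setminus\mathcal S}f_i(x,\overline u_i)\Big\}$$ under interval uncertainty $\mathcal U_k=[\overline u_k,\overline u_k+\Delta u_k]\subseteq\mathbb R^{L_k}$ (a box, componentwise interval) for some $\overline u_k,\Delta u_k\in\mathbb R^{L_k}_{\ge0}$, for all $k\in[m]$. If the uncertainty is linear, i.e. $f_k(x,u_k)=u_k^Tl_k(x)$ for all $x\in\mathcal X$, $u_k\in\mathcal U_k$ and functions $l_k:\mathcal X\to\mathbb R^{L_k}$, and $l_k(x)\ge0$ (componentwise) holds for all $x\in\mathcal X$ and all $k\in[m]$, then the $\Gamma$-counterpart is equivalent to $$\inf_{k\in[m]_0}\Big\{\inf_{\mathcal Q\subseteq[m]}\Big\{\inf_{x\in\mathcal X_{\mathcal Q}}\Big\{\Gamma\,\Delta u_k^Tl_k(x)+\sum_{i\in[m]}\overline u_i^Tl_i(x)+\sum_{q\in\mathcal Q}\big(\Delta u_q^Tl_q(x)-\Delta u_k^Tl_k(x)\big)\Big\}\Big\}\Big\},$$ with $\Delta u_0:=0$, $l_0(x):=0$ and (depending also on $k$) $$\mathcal X_{\mathcal Q}:=\{x\in\mathcal X:\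 \Delta u_q^Tl_q(x)-\Delta u_k^Tl_k(x)\ge0\ \forall q\in\mathcal Q,\ \ \Delta u_q^Tl_q(x)-\Delta u_k^Tl_k(x)\le0\ \forall q\in[m]\setminus\mathcal Q\}.$$
   Context: Notation: $[m]:=\{1,\dots,m\}$, $[m]_0:=\{0,1,\dots,m\}$. The infimum over the empty set is $+\infty$. Two minimization programs in $x$ (possibly with further auxiliary variables or indices) are called equivalent if they have the same optimal value in $[-\infty,\infty]$ and, whenever this value is finite, a point $x\in\mathcal X$ attains it in one program (for a suitable choice of the auxiliary variables or indices) if and only if it does so in the other. *)

(* Defs.v *)
From HB Require Import structures.
From mathcomp Require Import all_boot all_order all_algebra.
From mathcomp Require Import all_classical all_reals ereal.

Set Implicit Arguments.
Unset Strict Implicit.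
Unset Printing Implicit Defensive.

Import Order.TTheory GRing.Theory Num.Theory.

Local Open Scope classical_set_scope.
Local Open Scope ring_scope.

(* Minimization programs in a variable of type T, possibly nested under
   infima over further indices or auxiliary variables. *)
Inductive program (R : realType) (T : Type) : Type :=
| InfVar (F : set T) (obj : T -> \bar R)
| InfIndex (A : Type) (J : set A) (P : A -> program R T).

Fixpoint optval (R : realType) (T : Type) (P : program R T) : \bar R :=
  match P with
  | InfVar F obj => ereal_inf [set obj x | x in F]
  | InfIndex A J Q => ereal_inf [set optval (Q i) | i in J]
  end.

(* For some choice of the indices, x is feasible with objective value v. *)
Fixpoint reaches (R : realType) (T : Type) (P : program R T) (v : \bar R)
    (x : T) : Prop :=
  match P with
  | InfVar F obj => F x /\ obj x = v
  | InfIndex A J Q => exists2 i, J i & reaches (Q i) v x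
  end.

Definition attains (R : realType) (T : Type) (P : program R T) (x : T) : Prop :=
  reaches P (optval P) x.

Definition equivalent_programs (R : realType) (T : Type) (X : set T)
    (P P' : program R T) : Prop :=
  optval P = optval P' /\
  (optval P \is a fin_num -> forall x, X x -> (attains P x <-> attains P' x)).

(* X is contained in Z^p x R^(n-p). *)
Definition mixed_integer (R : realType) (n p : nat) (X : set 'cV[R]_n) : Prop :=
  forall x, X x -> forall j : 'I_n, (j < p)%N -> x j 0 \is a Num.int.

Definition dotv (R : realType) (d : nat) (u v : 'cV[R]_d) : R :=
  (u^T *m v) 0 0.

Definition nonneg_vec (R : realType) (d : nat) (u : 'cV[R]_d) : Prop :=
  forall j, 0 <= u j 0.

Definition box (R : realType) (d : nat) (a b : 'cV[R]_d) : set 'cV[R]_d :=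
  [set u | forall j, a j 0 <= u j 0 <= b j 0].

Section GammaCounterpart.
Variables (R : realType) (n m : nat) (L : 'I_m -> nat).
Variables (X : set 'cV[R]_n) (Gamma : nat).

Definition Gamma_objective
    (U : forall i : 'I_m, set 'cV[R]_(L i))
    (f : forall i : 'I_m, 'cV[R]_n -> 'cV[R]_(L i) -> R)
    (ubar : forall i : 'I_m, 'cV[R]_(L i)) (x : 'cV[R]_n) : \bar R :=
  ereal_sup [set (\sum_(i in S) ereal_sup [set (f i x u)%:E | u in U i] +
                  \sum_(i | i \notin S) (f i x (ubar i))%:E)%E
            | S in [set S : {set 'I_m} | (#|S| <= Gamma)%N]].

Definition Gamma_counterpart U f ubar : program R 'cV[R]_n :=
  InfVar X (Gamma_objective U f ubar).

Variables (ubar du : forall i : 'I_m, 'cV[R]_(L i)).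
Variable l : forall i : 'I_m, 'cV[R]_n -> 'cV[R]_(L i).

(* The index set {0, ..., m} is option 'I_m, with None in the role of 0. *)
Definition deviation (k : option 'I_m) (x : 'cV[R]_n) : R :=
  if k is Some i then dotv (du i) (l i x) else 0.

Definition X_restr (k : option 'I_m) (Q : {set 'I_m}) : set 'cV[R]_n :=
  [set x | [/\ X x,
    forall q, q \in Q -> 0 <= deviation (Some q) x - deviation k x &
    forall q, q \notin Q -> deviation (Some q) x - deviation k x <= 0]].

Definition reform_objective (k : option 'I_m) (Q : {set 'I_m})
    (x : 'cV[R]_n) : R :=
  Gamma%:R * deviation k x + \sum_(i < m) dotv (ubar i) (l i x) +
  \sum_(q in Q) (deviation (Some q) x - deviation k x).

Definition reformulation : program R 'cV[R]_n :=
  InfIndex [set: option 'I_m] (fun k =>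
    InfIndex [set: {set 'I_m}] (fun Q =>
      InfVar (X_restr k Q) (fun x => (reform_objective k Q x)%:E))).

End GammaCounterpart.

(* Main.v *)
Require Import Defs.
From HB Require Import structures.
From mathcomp Require Import all_boot all_order all_algebra.
From mathcomp Require Import all_classical all_reals ereal.

Set Implicit Arguments.
Unset Strict Implicit.
Unset Printing Implicit Defensive.

Import Order.TTheory GRing.Theory Num.Theory.

Local Open Scope classical_set_scope.
Local Open Scope ring_scope.

(** Fix a feasible x and write d_i for the worst-case deviation
    du_i^T l_i(x) >= 0.  Since l_i(x) >= 0, each inner supremum is attained at
    the upper corner of the box, so the Gamma-objective at x is the nominal
    value plus V, the largest sum of at most Gamma of the numbers d_i.

    The value V is that of a linear program (the fractional knapsack of
    capacity Gamma over the cube [0,1]^m), whose dual is the minimum over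
    t >= 0 of Gamma t + sum_i max(d_i - t, 0).  A reformulated objective for
    an index k and a set Q is the nominal value plus this dual function at
    t = d_k: membership of x in X_Q says exactly that Q selects the terms with
    positive part d_q - t.  Two facts then suffice:
    - weak duality ([sum_le_threshold]): every dual value bounds every sum of
      at most Gamma deviations;
    - tightness ([exists_top_subset]): if Q consists of Gamma largest
      deviations and k indexes the smallest among them, the dual value at d_k
      telescopes to the sum over Q.
    Hence at every x the Gamma-objective is the least value that the
    reformulation reaches at x, and it is reached; an infimum can be
    taken pointwise first, which gives equality of the optimal values and of
    the minimizers ([equivalent_programs_pointwise_min]). *)

(** * Nested minimization programs *)

(** Infima over indices and over the variable commute and merge into one, so
    optimality can be discussed through reachable values alone. *)
Lemma optval_reaches (R : realType) (T : Type) (P : program R T) :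
  optval P = ereal_inf [set v | exists x, reaches P v x].
Proof.
elim: P => [F obj|A J Q IH] /=.
  congr ereal_inf; apply/seteqP; split => v /=.
    by case=> x Fx <-; exists x.
  by case=> x [Fx <-]; exists x.
apply/le_anti/andP; split.
  apply: le_ereal_inf_tmp => v [x [i Ji Qx]].
  apply: (@le_trans _ _ (optval (Q i))); first by apply: ereal_inf_lbound; exists i.
  by rewrite IH; apply: ereal_inf_lbound; exists x.
apply: le_ereal_inf_tmp => _ [i Ji <-]; rewrite IH.
apply: le_ereal_inf_tmp => v [x Qx].
by apply: ereal_inf_lbound; exists x; exists i.
Qed.

Lemma equivalent_programs_pointwise_min (R : realType) (T : Type) (X : set T)
    (g : T -> \bar R) (P : program R T) :
  (forall v x, reaches P v x -> X x /\ (g x <= v)%E) ->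
  (forall x, X x -> reaches P (g x) x) ->
  equivalent_programs X (InfVar X g) P.
Proof.
move=> Pge Pg.
have optE : optval (InfVar X g) = optval P.
  rewrite optval_reaches [RHS]optval_reaches; apply/le_anti/andP; split.
    apply: le_ereal_inf_tmp => v [x /Pge[Xx gxv]].
    by apply: le_trans gxv; apply: ereal_inf_lbound; exists x.
  apply: le_ereal_inf_tmp => _ [x [Xx <-]].
  by apply: ereal_inf_lbound; exists x; exact: Pg.
split=> // _ x Xx; rewrite /attains -optE /=; split.
  by case=> _ <-; exact: Pg.
move=> /Pge[_ gx]; split=> //; apply/le_anti; rewrite gx /=.
by apply: ereal_inf_lbound; exists x.
Qed.

(** * Largest sums of at most r numbers *)

(** Each term of the left-hand sum is t plus d i - t; the copies of t number at
    most r, and replacing the index set S by Q only drops nonpositive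
    differences and adds nonnegative ones. *)
Lemma sum_le_threshold (R : realDomainType) (I : finType) (d : I -> R) (t : R)
    (r : nat) (S Q : {set I}) :
  0 <= t -> (#|S| <= r)%N ->
  (forall q, q \in Q -> 0 <= d q - t) ->
  (forall q, q \notin Q -> d q - t <= 0) ->
  \sum_(i in S) d i <= r%:R * t + \sum_(q in Q) (d q - t).
Proof.
move=> t0 Sr Qge Qle.
have -> : \sum_(i in S) d i = #|S|%:R * t + \sum_(i in S) (d i - t).
  by rewrite sumrB sumr_const mulr_natl addrC subrK.
apply: lerD; first by rewrite ler_wpM2r// ler_nat.
rewrite big_mkcond [leRHS]big_mkcond; apply: ler_sum => i _.
have [iS|_] := boolP (i \in S); have [/Qge|/Qle] := boolP (i \in Q) => //.
Qed.

(** Among the r-element sets take one of largest sum: if an outside element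
    exceeded the smallest inside one, exchanging the two would increase the
    sum. *)
Lemma exists_top_subset (R : realDomainType) (I : finType) (d : I -> R)
    (r : nat) :
  (0 < r <= #|I|)%N ->
  exists (S : {set I}) (k : I), [/\ #|S| = r,
    forall q, q \in S -> d k <= d q & forall q, q \notin S -> d q <= d k].
Proof.
move=> /andP[r0 rI].
have [S0 S0r] : exists S0 : {set I}, #|S0| == r.
  have : (0 < #|[set A : {set I} | #|A| == r]%SET|)%N by rewrite card_draws bin_gt0.
  by case/card_gt0P => S0; rewrite inE; exists S0.
case: (@arg_maxP _ _ _ S0 (fun S : {set I} => #|S| == r)
  (fun S : {set I} => \sum_(i in S) d i)) => // S /eqP Sr Smax.
have [k0 k0S] : exists k0, k0 \in S by apply/card_gt0P; rewrite Sr.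
case: (@arg_minP _ _ _ k0 (fun k => k \in S) d) => // k kS kmin.
exists S, k; split=> // q qS.
have qSk : q \notin S :\ k by rewrite !inE negb_and qS orbT.
have /Smax : #|q |: (S :\ k)| == r.
  by rewrite cardsU1 qSk -Sr (cardsD1 k S) kS.
by rewrite big_setU1//= [leRHS](big_setD1 k)//= lerD2r.
Qed.

(** * The worst case over a box and over subsets *)

Lemma ereal_sup_max (R : realType) (A : set (\bar R)) (v : \bar R) :
  A v -> (forall w, A w -> (w <= v)%E) -> ereal_sup A = v.
Proof.
move=> Av vub; apply/le_anti/andP; split; first exact: ge_ereal_sup.
exact: ereal_sup_ubound.
Qed.

Lemma dotvE (R : realType) (d : nat) (u v : 'cV[R]_d) :
  dotv u v = \sum_j u j 0 * v j 0.
Proof. by rewrite /dotv mxE; apply: eq_bigr => j _; rewrite mxE. Qed.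

Lemma dotvDl (R : realType) (d : nat) (u w v : 'cV[R]_d) :
  dotv (u + w) v = dotv u v + dotv w v.
Proof. by rewrite /dotv linearD mulmxDl mxE. Qed.

Lemma dotv_ge0 (R : realType) (d : nat) (u v : 'cV[R]_d) :
  nonneg_vec u -> nonneg_vec v -> 0 <= dotv u v.
Proof. by move=> u0 v0; rewrite dotvE; apply: sumr_ge0 => j _; apply: mulr_ge0. Qed.

Lemma box_left (R : realType) (d : nat) (a w : 'cV[R]_d) :
  nonneg_vec w -> box a (a + w) a.
Proof. by move=> w0 j; rewrite lexx mxE lerDl /=. Qed.

Lemma box_right (R : realType) (d : nat) (a w : 'cV[R]_d) :
  nonneg_vec w -> box a (a + w) (a + w).
Proof. by move=> w0 j; rewrite lexx mxE lerDl w0. Qed.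

(** A linear form with nonnegative coefficients is monotone in every
    coordinate, so its maximum over a box is at the upper corner. *)
Lemma ereal_sup_dotv_box (R : realType) (d : nat) (a w v : 'cV[R]_d) :
  nonneg_vec w -> nonneg_vec v ->
  ereal_sup [set (dotv u v)%:E | u in box a (a + w)]
    = (dotv a v + dotv w v)%:E.
Proof.
move=> w0 v0; apply: ereal_sup_max.
  by exists (a + w); [exact: box_right|rewrite dotvDl].
move=> _ [u ub <-]; rewrite lee_fin -dotvDl !dotvE; apply: ler_sum => j _.
by apply: ler_wpM2r; [exact: v0|have /andP[] := ub j].
Qed.

(** * The Gamma-counterpart *)

Section Linear.
Variables (R : realType) (n m Gamma : nat) (L : 'I_m -> nat).
Variables (X : set 'cV[R]_n) (f : forall k : 'I_m, 'cV[R]_n -> 'cV[R]_(L k) -> R).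
Variables (l : forall k : 'I_m, 'cV[R]_n -> 'cV[R]_(L k)).
Variables (ubar du : forall k : 'I_m, 'cV[R]_(L k)).
Variables (U : forall k : 'I_m, set 'cV[R]_(L k)).
Arguments f : clear implicits.
Arguments U : clear implicits.
Hypothesis hdu : forall k, nonneg_vec (du k).
Hypothesis hU : forall k, U k = box (ubar k) (ubar k + du k).
Hypothesis hf : forall k x u, X x -> U k u -> f k x u = dotv u (l k x).
Hypothesis hl : forall k x, X x -> nonneg_vec (l k x).

Let nominal x := \sum_(i < m) dotv (ubar i) (l i x).
Let dev x (i : 'I_m) := dotv (du i) (l i x).

Lemma worst_case_given_subset x (S : {set 'I_m}) : X x ->
  (\sum_(i in S) ereal_sup [set (f i x u)%:E | u in U i] +
    \sum_(i | i \notin S) (f i x (ubar i))%:E)%E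
  = (nominal x + \sum_(i in S) dev x i)%:E.
Proof.
move=> Xx.
rewrite (eq_bigr (fun i => (dotv (ubar i) (l i x) + dev x i)%:E)); last first.
  move=> i _; rewrite -ereal_sup_dotv_box//; last exact: hl.
  rewrite -hU; congr ereal_sup; apply: eq_imagel => u Uu.
  by rewrite hf.
rewrite [X in (_ + X)%E](eq_bigr (fun i => (dotv (ubar i) (l i x))%:E)); last first.
  by move=> i _; rewrite hf// hU; exact: box_left.
rewrite !sumEFin -EFinD; congr EFin.
by rewrite big_split/= addrAC /nominal [in RHS](bigID (mem S)).
Qed.

Lemma Gamma_objective_le_reform x k Q : X_restr X du l k Q x ->
  (Gamma_objective Gamma U f ubar x
    <= (reform_objective Gamma ubar du l k Q x)%:E)%E.
Proof.
case=> Xx Qge Qle; apply: ge_ereal_sup => _ [S SG <-].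
rewrite worst_case_given_subset// lee_fin /reform_objective.
rewrite [_ * _ + _]addrC -addrA lerD2l.
apply: sum_le_threshold => //.
by case: k {Qge Qle} => //= k; apply: dotv_ge0 => //; exact: hl.
Qed.

(** The threshold index is always an element of [m]: as Gamma >= 1, a set of
    Gamma largest deviations has a smallest member. *)
Lemma Gamma_objective_reached x : (1 <= Gamma <= m)%N -> X x ->
  exists k Q, X_restr X du l k Q x /\
    (reform_objective Gamma ubar du l k Q x)%:E
      = Gamma_objective Gamma U f ubar x.
Proof.
move=> hGamma Xx.
have [|S [k [SG kS kNS]]] := @exists_top_subset _ 'I_m (dev x) Gamma.
  by rewrite card_ord.
have kSx : X_restr X du l (Some k) S x.
  by split=> // q qS; rewrite ?subr_ge0 ?subr_le0 ?kS ?kNS.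
exists (Some k), S; split=> //.
apply/le_anti; rewrite (Gamma_objective_le_reform kSx) andbT.
apply: ereal_sup_ubound; exists S; first by rewrite /= SG.
rewrite worst_case_given_subset//; congr EFin; rewrite /reform_objective.
(* the Gamma copies of the threshold cancel, as S has exactly Gamma elements *)
by rewrite sumrB sumr_const SG mulr_natl /= [_ *+ _ + _]addrC addrACA subrr addr0.
Qed.

End Linear.

Theorem theorem3p10 (R : realType) (n m p Gamma : nat) (L : 'I_m -> nat)
    (X : set 'cV[R]_n)
    (f : forall k : 'I_m, 'cV[R]_n -> 'cV[R]_(L k) -> R)
    (l : forall k : 'I_m, 'cV[R]_n -> 'cV[R]_(L k))
    (ubar du : forall k : 'I_m, 'cV[R]_(L k))
    (U : forall k : 'I_m, set 'cV[R]_(L k))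
    (hn : (1 <= n)%N) (hm : (1 <= m)%N) (hp : (p <= n)%N)
    (hX : mixed_integer p X)
    (hGamma : (1 <= Gamma <= m)%N)
    (hubar : forall k, nonneg_vec (ubar k))
    (hdu : forall k, nonneg_vec (du k))
    (hU : forall k, U k = box (ubar k) (ubar k + du k))
    (hf : forall k x u, X x -> U k u -> f k x u = dotv u (l k x))
    (hl : forall k x, X x -> nonneg_vec (l k x)) :
  equivalent_programs X (Gamma_counterpart X Gamma U f ubar)
    (reformulation X Gamma ubar du l).
Proof.
apply: equivalent_programs_pointwise_min => [v x|x Xx].
  move=> [k _ [Q _ [kQx <-]]]; split; first by case: kQx.
  exact: (Gamma_objective_le_reform Gamma hdu hU hf hl kQx).
have [k [Q [kQx E]]] := Gamma_objective_reached hdu hU hf hl hGamma Xx.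
by exists k => //; exists Q.
Qed.
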